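(* Let $0<p_1,\ldots,p_m,p<\infty$ and $0<q_1,\ldots,q_m,q\leq\infty$. Let $K$ be a nonnegative measurable function on $(\mathbb{R}^n)^m$ that is nonzero on a set of positive measure. If there exists a positive constant $C_K$ such that $$\big\|T^K(f_1,\ldots,f_m)\big\|_{p,q}\leq C_K\prod_{i=1}^m\|f_i\|_{p_i,q_i}$$ for all $f_i\in L^{p_i,q_i}(\mathbb{R}^n)$, $i=1,\ldots,m$, then we must have $$\frac1p\leq\sum_{i=1}^m\frac1{p_i}.$$ Moreover, if equality holds in this last inequality, i.e. $\frac1p=\sum_{i=1}^m\frac1{p_i}$, then necessarily $$\frac1q\leq\sum_{i=1}^m\frac1{q_i}.$$
   Context: Here $n,m$ are positive integers and $1/\infty=0$. For a measurable function $f$ on a Euclidean space, $f^*(t)=\inf\{\lambda\ge 0: |\{|f|>\lambda\}|\le t\}$ is its decreasing rearrangement. For $0<p<\infty$, set $\|f\|_{p,q}=\left(\int_0^\infty (t^{1/p}f^*(t))^q\,\frac{dt}{t}\right)^{1/q}$ if $0<q<\infty$ and $\|f\|_{p,\infty}=\sup_{t>0}t^{1/p}f^*(t)$. The Lorentz space $L^{p,q}$ consists of all measurable $f$ with $\|f\|_{p,q}<\infty$. For a measurable function $K$ on $(\mathbb{R}^n)^m$ and measurable functions $f_1,\ldots,f_m$ on $\mathbb{R}^n$, $$T^K(f_1,\ldots,f_m)(x)=\int_{(\mathbb{R}^n)^m}\Big(\prod_{i=1}^m f_i(x-y_i)\Big)K(y_1,\ldots,y_m)\,dy_1\cdots dy_m,$$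 defined at those $x$ where the integral converges absolutely. For nonnegative $f_i$ and $K$ it is well defined with values in $[0,\infty]$. Since $|T^K(f_1,\ldots,f_m)|\le T^{|K|}(|f_1|,\ldots,|f_m|)$, one uses the standard reduction to nonnegative functions. *)

(* Defs.v *)
From HB Require Import structures.
From mathcomp Require Import all_boot all_order all_algebra.
From mathcomp Require Import all_classical all_reals all_analysis.

Set Implicit Arguments.
Unset Strict Implicit.
Unset Printing Implicit Defensive.

Import Order.TTheory GRing.Theory Num.Theory.
Import numFieldNormedType.Exports.

Local Open Scope classical_set_scope.
Local Open Scope ring_scope.

(** [power_measure mu k] is the product of [k] copies of [mu], on the product
    sigma-algebra of [k.-tuple T]; it is built by induction on [k] from the
    binary product [\x] of the library, through [T * k.-tuple T -> k.+1.-tuple T]. *)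

Definition cons_pair (T : Type) (k : nat) (u : T * k.-tuple T) : k.+1.-tuple T :=
  [tuple of u.1 :: u.2].

Section cons_measure.
Context d (T : measurableType d) (R : realType) (k : nat).
Variable mu : {sigma_finite_measure set T -> \bar R}.
Variable nu : {sigma_finite_measure set (k.-tuple T) -> \bar R}.
Local Open Scope ereal_scope.

Lemma measurable_cons_pair : measurable_fun setT (@cons_pair T k).
Proof.
exact: (measurable_cons measurable_fst measurable_snd).
Qed.

Definition cons_measure : set (k.+1.-tuple T) -> \bar R :=
  pushforward (mu \x nu) (@cons_pair T k).

Let cons_measure0 : cons_measure set0 = 0.
Proof. by rewrite /cons_measure /pushforward preimage_set0 measure0. Qed.

Let cons_measure_ge0 A : 0 <= cons_measure A.
Proof. exact: (measure_ge0 (mu \x nu)). Qed.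

Let cons_measure_sigma_additive : semi_sigma_additive cons_measure.
Proof.
move=> F mF tF mUF; rewrite /cons_measure /pushforward preimage_bigcup.
have mpre A : measurable A -> measurable (@cons_pair T k @^-1` A).
  by move=> mA; rewrite -[X in measurable X]setTI; exact: measurable_cons_pair.
apply: measure_semi_sigma_additive.
- by move=> i; exact: mpre.
- apply/trivIsetP => i j _ _ ij; rewrite -preimage_setI.
  by move/trivIsetP : tF => /(_ _ _ _ _ ij) ->//; rewrite preimage_set0.
- by rewrite -preimage_bigcup; exact: mpre.
Qed.

HB.instance Definition _ := isMeasure.Build _ _ _ cons_measure
  cons_measure0 cons_measure_ge0 cons_measure_sigma_additive.

Let cons_measure_sigma_finite : sigma_finite setT cons_measure.
Proof.
have /sigma_finiteP[F [UF ndF Foo]] := sigma_finiteT mu.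
have /sigma_finiteP[G [UG ndG Goo]] := sigma_finiteT nu.
pose split_tuple (t : k.+1.-tuple T) := (thead t, [tuple of behead t]).
have ms : measurable_fun setT split_tuple.
  by apply/measurable_fun_pair; [exact: measurable_tnth|exact: measurable_behead].
have splitK u : split_tuple (cons_pair u) = u.
  by case: u => x t; congr pair => //; exact: val_inj.
exists (fun i => split_tuple @^-1` (F i `*` G i)).
  apply/esym/seteqP; split=> // t _.
  have [i _ Fi] : (\bigcup_i F i) (thead t) by rewrite -UF.
  have [j _ Gj] : (\bigcup_i G i) [tuple of behead t] by rewrite -UG.
  exists (maxn i j) => //; split.
  - have /subsetPset := ndF _ _ (leq_maxl i j); exact.
  - have /subsetPset := ndG _ _ (leq_maxr i j); exact.
move=> i; have [mF Foo_i] := Foo i; have [mG Goo_i] := Goo i; split.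
  by rewrite -[X in measurable X]setTI; apply: ms => //; exact: measurableX.
rewrite /cons_measure /pushforward -comp_preimage.
rewrite (_ : split_tuple \o _ = id) ?preimage_id; last exact/funext/splitK.
by rewrite product_measure1E// lte_mul_pinfty// ge0_fin_numE.
Qed.

HB.instance Definition _ := Measure_isSigmaFinite.Build _ _ _ cons_measure
  cons_measure_sigma_finite.

End cons_measure.

Fixpoint power_measure d (T : measurableType d) (R : realType)
    (mu : {sigma_finite_measure set T -> \bar R}) (k : nat) :
    {sigma_finite_measure set (k.-tuple T) -> \bar R} :=
  match k return {sigma_finite_measure set (k.-tuple T) -> \bar R} with
  | 0 => \d_([tuple] : 0.-tuple T)
  | k'.+1 => cons_measure mu (power_measure mu k')
  end.

(** Lebesgue measure on [R^n] and on [(R^n)^m] is the Caratheodory extension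
    of the product measure on Borel sets, so that
    "measurable" below means Lebesgue measurable (all null sets included).
    A point of [euclid R n] is an [n.-tuple R], and a point of
    [euclid_pow R n m] is an [m.-tuple (n.-tuple R)]. *)

Definition borel_lebesgue (R : realType) (n : nat) :
    {sigma_finite_measure set (n.-tuple (measurableTypeR R)) -> \bar R} :=
  power_measure lebesgue_measure n.

Definition borel_lebesgue_pow (R : realType) (n m : nat) :
    {sigma_finite_measure
      set (m.-tuple (n.-tuple (measurableTypeR R))) -> \bar R} :=
  power_measure (borel_lebesgue R n) m.

Notation euclid R n := (caratheodory_type (borel_lebesgue R n)^*%mu).
Notation euclid_pow R n m := (caratheodory_type (borel_lebesgue_pow R n m)^*%mu).

Definition lebesgue (R : realType) (n : nat) :
    {measure set (euclid R n) -> \bar R} :=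
  @completed_measure_extension _ _ _ (borel_lebesgue R n).

Definition lebesgue_pow (R : realType) (n m : nat) :
    {measure set (euclid_pow R n m) -> \bar R} :=
  @completed_measure_extension _ _ _ (borel_lebesgue_pow R n m).

Section lorentz.
Context d (T : measurableType d) (R : realType).
Variable mu : {measure set T -> \bar R}.
Local Open Scope ereal_scope.

Definition rearrangement (f : T -> \bar R) (t : R) : \bar R :=
  ereal_inf [set l%:E | l in
    [set l : R | (0 <= l)%R /\ mu [set x | l%:E < `|f x|] <= t%:E]].

(* Meant for [q] in ]0, +oo] only. *)
Definition lorentz_norm (p : R) (q : \bar R) (f : T -> \bar R) : \bar R :=
  match q with
  | r%:E => (\int[lebesgue_measure]_(t in `]0%R, +oo[)
              (((t `^ p^-1)%:E * rearrangement f t) `^ r * (t^-1)%:E)) `^ r^-1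
  | +oo => ereal_sup [set (t `^ p^-1)%:E * rearrangement f t | t in `]0%R, +oo[]
  | -oo => 0
  end.

Definition lorentz_space (p : R) (q : \bar R) : set (T -> R) :=
  [set f | measurable_fun setT f /\ lorentz_norm p q (EFin \o f) < +oo].

End lorentz.

Definition euclid_sub (R : realType) (n : nat) (x y : n.-tuple R) : n.-tuple R :=
  [tuple tnth x j - tnth y j | j < n].

(* The integral in [\bar R] is total: it is the usual one wherever it converges
   absolutely, it has values in [0, +oo] for nonnegative functions, and it is
   infinite (hence of modulus +oo) at the remaining points. *)
Definition multilinear_conv (R : realType) (n m : nat)
    (K : euclid_pow R n m -> R) (f : 'I_m -> euclid R n -> R)
    (x : euclid R n) : \bar R :=
  (\int[lebesgue_pow R n m]_y
     ((\prod_(i < m) f i (euclid_sub x (tnth y i))) * K y)%:E)%E.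

(* Main.v *)
Require Import Defs.
From mathcomp Require Import all_boot all_order all_algebra.
From mathcomp Require Import all_classical all_reals all_analysis.
From mathcomp Require Import measurable_realfun lra.

(** The proof tests the inequality on truncated homogeneous functions.  Let
    [V x] be the measure of the smallest cube centred at the origin containing
    [x], so that [{V <= t}] has measure [t].  For [0 < v < w] take
    [f_i = max(V, v)^(-1/p_i)] on [{V <= w}] and [0] elsewhere.  Then
    [t^(1/p_i) f_i^*(t)] is at most [1], is at most [(t/v)^(1/p_i)] below [v]
    and vanishes beyond [w], so that [||f_i||_(p_i,q_i)] is at most a constant
    times [ln(w/v)^(1/q_i)] once [ln(w/v) >= 1] ([lorentz_norm_profile_le]).

    Conversely, [K] has positive mass [c] on some product of cubes [{V <= v0}]
    ([kernel_mass_near0]).  If [y_i] lies in that cube and [v >= v0], then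
    [V (x - y_i) <= 2^n max(V x, v)], so that
    [T^K(f_1,...,f_m)(x) >= c (2^n max(V x, v))^(-s)] with [s = sum 1/p_i], as
    long as [2^n max(V x, v) <= w] ([multilinear_conv_profile_ge]).
    Choosing [w = 2^(n+1) v e^L] this gives
    [t^(1/p) (T^K f)^*(t) >= c' v^(1/p-s)] for [t] in [[v, v e^L]] as soon as
    [1/p >= s], hence a norm of at least [c' v^(1/p-s) L^(1/q)]
    ([multilinear_conv_lorentz_ge]).

    Altogether [c' v^(1/p-s) L^(1/q) <= M L^(sum 1/q_i)] for all large [v] and
    all [L >= 1] ([scaling_estimate]).  If [1/p > s], this fails for [L = 1]
    and [v] tending to infinity; if [1/p = s], letting [L] tend to infinity
    forces [1/q <= sum 1/q_i]. *)

Set Implicit Arguments.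
Unset Strict Implicit.
Unset Printing Implicit Defensive.

Import Order.TTheory GRing.Theory Num.Theory.
Import numFieldNormedType.Exports.

Local Open Scope classical_set_scope.
Local Open Scope ring_scope.
Local Open Scope ereal_scope.

(** * Integrals over intervals of the half-line *)

(** The integral of a nonnegative function is a supremum over the simple
    functions below it, which is monotone for arbitrary functions.  This
    allows estimates of rearrangements and convolutions of unknown
    measurability. *)
Lemma ge0_le_integral_nonmeas d (T : measurableType d) (R : realType)
    (mu : {measure set T -> \bar R}) (D : set T) (f g : T -> \bar R) :
  (forall x, D x -> 0 <= f x) -> (forall x, D x -> f x <= g x) ->
  \int[mu]_(x in D) f x <= \int[mu]_(x in D) g x.
Proof.
move=> f0 fg.
have g0 x : D x -> 0 <= g x by move=> Dx; exact: le_trans (f0 _ Dx) (fg _ Dx).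
rewrite !ge0_integralE//; apply: le_ereal_sup => _ [h /= hf <-].
exists h => //= x.
by apply: (le_trans (hf x)); exact: lee_restrict.
Qed.

Lemma integral_itv_FTC (R : realType) (f F : R -> R) (a b : R) :
  (0 < a)%R -> (a < b)%R ->
  (forall x : R, (0 < x)%R -> {for x, continuous f}) ->
  (forall x : R, (0 < x)%R -> is_derive x 1%R F (f x)) ->
  \int[lebesgue_measure]_(t in `[a, b]) (f t)%:E = (F b - F a)%:E.
Proof.
move=> a0 ab cf dF.
have cF (x : R) : (0 < x)%R -> {for x, continuous F}.
  by move=> x0; apply/differentiable_continuous/derivable1_diffP; have [] := dF x x0.
rewrite (@continuous_FTC2 _ f F a b)//.
- apply: continuous_in_subspaceT => x; rewrite inE/= in_itv/= => /andP[ax _].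
  by apply: cf; exact: lt_le_trans ax.
- split.
  + by move=> x; rewrite in_itv/= => /andP[ax _]; have [] := dF x (lt_trans a0 ax).
  + by apply: cvg_at_right_filter; exact: cF.
  + by apply: cvg_at_left_filter; apply: cF; exact: lt_trans ab.
- move=> x; rewrite in_itv/= => /andP[ax _]; rewrite derive1E.
  by have [_ ->] := dF x (lt_trans a0 ax).
Qed.

Lemma integral_invr_itv (R : realType) (a b : R) : (0 < a)%R -> (a < b)%R ->
  \int[lebesgue_measure]_(t in `[a, b]) (t^-1)%:E = (ln b - ln a)%:E.
Proof.
move=> a0 ab; apply: integral_itv_FTC => // x x0.
by apply: inv_continuous; rewrite gt_eqF.
Qed.

(** The integrand is singular at [0] when [s < 1], so the fundamental theorem of
    calculus only applies on [[v / (k + 2), v]]; the bound is uniform in [k] and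
    passes to the limit. *)
Lemma integral_powR_near0 (R : realType) (s v : R) : (0 < s)%R -> (0 < v)%R ->
  \int[lebesgue_measure]_(t in `]0%R, v]) (t `^ (s - 1))%:E <= (v `^ s / s)%:E.
Proof.
move=> s0 v0.
pose D (k : nat) : set R := `[(v / k.+2%:R)%R, v]%classic.
have vk0 k : (0 < v / k.+2%:R)%R by rewrite divr_gt0.
have UD : \bigcup_k D k = [set` `]0%R, v]].
  apply/seteqP; split=> [x [k _]|x]; rewrite /D/= !in_itv/= => /andP[h xv].
    by rewrite (lt_le_trans (vk0 k) h).
  have [k hk] : exists k, (v / x < k%:R)%R.
    by exists (Num.truncn (v / x)).+1; rewrite truncnS_gt.
  exists k => //; rewrite /= in_itv/= xv andbT ler_pdivrMr// mulrC -ler_pdivrMr//.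
  by rewrite (le_trans (ltW hk))// ler_nat -addn2 leq_addr.
have cvgI : \int[lebesgue_measure]_(t in D i) (t `^ (s - 1))%:E @[i --> \oo] -->
    \int[lebesgue_measure]_(t in \bigcup_k D k) (t `^ (s - 1))%:E.
  apply: ge0_nondecreasing_set_cvg_integral.
  - move=> i j ij; apply/subsetPset => x; rewrite /D/= !in_itv/= => /andP[h ->].
    rewrite andbT (le_trans _ h)// ler_pM2l// lef_pV2 ?posrE//.
    by rewrite ler_nat !ltnS.
  - by move=> i; exact: measurable_itv.
  - move=> i; apply/measurable_EFinP; apply: measurable_funTS.
    exact: measurable_powR.
  - by move=> i x _; rewrite lee_fin powR_ge0.
rewrite -UD -(cvg_lim _ cvgI)//; apply: lime_le.
  by apply/cvg_ex; eexists; exact: cvgI.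
near=> k.
have dF (x : R) : (0 < x)%R ->
    is_derive x 1%R (fun t => t `^ s / s)%R (x `^ (s - 1))%R.
  move=> x0; have h := is_derive1_powR s x0.
  have -> : (fun t : R => t `^ s / s)%R = (s^-1 \*: (fun t : R => t `^ s))%R.
    by apply/funext => t /=; rewrite mulrC.
  have -> : (x `^ (s - 1) = s^-1 *: (s * x `^ (s - 1)))%R.
    by rewrite /GRing.scale/= mulKf// gt_eqF.
  exact: is_deriveZ.
have cf (x : R) : (0 < x)%R -> {for x, continuous (fun t : R => t `^ (s - 1))%R}.
  move=> x0; apply/differentiable_continuous/derivable1_diffP.
  by apply: derivable_powR; rewrite in_itv/= x0.
have kv : (v / k.+2%:R < v)%R by rewrite ltr_pdivrMr// ltr_pMr// ltr1n.
rewrite /D (integral_itv_FTC (vk0 k) kv cf dF).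
by rewrite lee_fin lerBlDr lerDl divr_ge0 ?powR_ge0// ltW.
Unshelve. all: by end_near. Qed.

Lemma measurable_inv_itv (R : realType) (a b : R) : (0 < a)%R ->
  measurable_fun `[a, b] (fun t : R => (t^-1)%:E).
Proof.
move=> a0; apply/measurable_EFinP.
apply: subspace_continuous_measurable_fun; first exact: measurable_itv.
apply: continuous_in_subspaceT => x; rewrite inE/= in_itv/= => /andP[ax _].
by apply: inv_continuous; rewrite gt_eqF// (lt_le_trans a0).
Qed.

(** * Power growth and lower bounds for Lorentz norms *)

(** An inequality between powers at infinity orders the exponents: otherwise
    [x^(a - b)] would stay below [M / c], whereas it is unbounded. *)
Lemma powR_growth_le (R : realType) (a b c M x0 : R) : (0 < c)%R ->
  (forall x, x0 <= x -> c * x `^ a <= M * x `^ b)%R -> (a <= b)%R.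
Proof.
move=> c0 h; rewrite leNgt; apply/negP => ba.
have ab0 : (0 < a - b)%R by rewrite subr_gt0.
pose y : R := (`|M / c| + 1)%R.
have y0 : (0 < y)%R by rewrite /y ltr_wpDl.
pose x : R := (Num.max x0 (y `^ (a - b)^-1))%R.
have yx : (y `^ (a - b)^-1 <= x)%R by rewrite le_max lexx orbT.
have x_gt0 : (0 < x)%R by rewrite (lt_le_trans _ yx)// powR_gt0.
have : (c * x `^ a <= M * x `^ b)%R by apply: h; rewrite le_max lexx.
have -> : (x `^ a = x `^ (a - b) * x `^ b)%R.
  by rewrite -powRD ?subrK// (gt_eqF x_gt0) implybT.
rewrite mulrA ler_pM2r ?powR_gt0// mulrC -ler_pdivlMr// => xM.
have : (y <= x `^ (a - b))%R.
  have := ge0_ler_powR (ltW ab0) (powR_ge0 y (a - b)^-1) (ltW x_gt0) yx.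
  by rewrite -powRrM mulVf ?gt_eqF// powRr1// ltW.
have := ler_norm (M / c); rewrite /y; lra.
Qed.

Definition inv_exponent (R : realType) (q : \bar R) : R :=
  if q is r%:E then (r^-1)%R else 0%R.

Section lorentz_lower_bound.
Context d (T : measurableType d) (R : realType).
Variable mu : {measure set T -> \bar R}.
Implicit Types (F : T -> \bar R) (p t : R) (q : \bar R).

Lemma rearrangement_ge0 F t : 0 <= rearrangement mu F t.
Proof. by apply: le_ereal_inf_tmp => _ [l [l0 _] <-]; rewrite lee_fin. Qed.

(** A level [l < s] is exceeded on all of [A], hence on a set of measure larger
    than [t].  Monotonicity of [mu] is a hypothesis because the superlevel sets
    of [F] need not be measurable; it holds for any restriction of an outer
    measure. *)
Lemma rearrangement_ge F (A : set T) (s t : R) :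
  (forall B, A `<=` B -> mu A <= mu B) -> t%:E < mu A ->
  (forall x, A x -> s%:E <= `|F x|) -> s%:E <= rearrangement mu F t.
Proof.
move=> muA tA sF; apply: le_ereal_inf_tmp => _ [l [l0 lt] <-].
rewrite leNgt; apply/negP => ls.
have : mu A <= t%:E.
  by apply: le_trans lt; apply: muA => x /sF; exact: lt_le_trans.
by rewrite leNgt tA.
Qed.

(** The factor [ln (b / a)] is the mass of [[a, b]] for the measure [dt/t]. *)
Lemma lorentz_norm_ge F p q (D a b : R) : 0 < q ->
  (0 <= D)%R -> (0 < a)%R -> (a < b)%R ->
  (forall t, (a <= t <= b)%R ->
     D%:E <= (t `^ p^-1)%:E * rearrangement mu F t) ->
  (D * ln (b / a) `^ inv_exponent q)%:E <= lorentz_norm mu p q F.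
Proof.
move=> q0 D0 a0 ab DF; have b0 := lt_trans a0 ab.
case: q q0 => [r| |]//=; last first.
  move=> _; rewrite powRr0 mulr1.
  apply: (le_trans (DF a _)); first by rewrite lexx ltW.
  by apply: ereal_sup_ubound; exists a => //=; rewrite in_itv/= a0.
rewrite lte_fin => r0.
have lnba : (0 <= ln (b / a))%R.
  by rewrite ln_ge0// ler_pdivlMr// mul1r ltW.
have -> : (D * ln (b / a) `^ r^-1)%:E = ((D `^ r * ln (b / a))%:E `^ r^-1).
  by rewrite poweR_EFin powRM ?powR_ge0// -powRrM mulfV ?gt_eqF// powRr1.
apply: gt0_ler_poweR; rewrite ?invr_ge0 ?(ltW r0)//.
- by rewrite in_itv/= lee_fin mulr_ge0 ?powR_ge0//= leey.
- rewrite in_itv/= leey andbT integral_ge0// => t; rewrite /= in_itv/= andbT.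
  by move=> t0; rewrite mule_ge0 ?poweR_ge0// lee_fin invr_ge0 ltW.
rewrite ln_div ?posrE// EFinM -integral_invr_itv//.
rewrite -ge0_integralZl//=; last 3 first.
- exact: measurable_inv_itv.
- move=> x; rewrite in_itv/= => /andP[ax _].
  by rewrite lee_fin invr_ge0 (le_trans (ltW a0)).
- by rewrite lee_fin powR_ge0.
rewrite integral_mkcond [leRHS]integral_mkcond.
apply: ge0_le_integral_nonmeas => t _.
  rewrite patchE; case: ifPn => [|//]; rewrite inE/= in_itv/= => /andP[h _].
  by rewrite lee_fin mulr_ge0 ?powR_ge0// invr_ge0 (le_trans (ltW a0)).
rewrite !patchE; case: ifPn => [|_]; rewrite ?inE/= ?in_itv/=.
  move=> /andP[h1 h2]; have t0 := lt_le_trans a0 h1.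
  rewrite mem_set; last by rewrite /= in_itv/= t0.
  rewrite -poweR_EFin lee_pmul ?poweR_ge0// ?lee_fin ?invr_ge0 ?(ltW t0)//.
  have D_le : D%:E <= (t `^ p^-1)%:E * rearrangement mu F t.
    by apply: DF; rewrite h1.
  apply: gt0_ler_poweR => //; rewrite ?(ltW r0)// in_itv/= leey andbT.
    by rewrite lee_fin.
  by apply: le_trans D_le; rewrite lee_fin.
case: ifPn => [|//]; rewrite inE/= in_itv/= andbT => t0.
by rewrite mule_ge0 ?poweR_ge0// lee_fin invr_ge0 ltW.
Qed.

End lorentz_lower_bound.

(** * Truncated homogeneous functions *)

Section profile.
Context d (T : measurableType d) (R : realType).
Variables (mu : {measure set T -> \bar R}) (V : T -> R).
Hypothesis mV : measurable_fun setT V.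
Hypothesis mu_sublevel : forall t : R, (0 <= t)%R -> mu [set x | (V x <= t)%R] = t%:E.
Implicit Types (v w t p : R) (q : \bar R).

(** [profile v w p] is the homogeneous function [V^(-1/p)], flattened below [v]
    to make it bounded and cut off beyond [w].  For [v <= V <= w] it lies on
    the critical decay line of [L^(p,q)], so its norm only sees [ln (w / v)]. *)
Definition profile v w p (x : T) : R :=
  if (V x <= w)%R then (Num.max (V x) v `^ (- p^-1))%R else 0%R.

Lemma profile_ge0 v w p x : (0 <= profile v w p x)%R.
Proof. by rewrite /profile; case: ifPn => // _; rewrite powR_ge0. Qed.

Lemma measurable_profile v w p : measurable_fun setT (profile v w p).
Proof.
apply: measurable_fun_ifT.
- exact: measurable_fun_ler.
- apply: (measurableT_comp (measurable_powR _)).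
  exact: measurable_maxr.
- exact: measurable_cst.
Qed.

Lemma rearrangement_profile_le v w p t : (0 < v)%R -> (0 < p)%R -> (0 < t)%R ->
  rearrangement mu (EFin \o profile v w p) t <=
  (if t < w then Num.max t v `^ (- p^-1) else 0)%R%:E.
Proof.
move=> v0 p0 t0; apply: ereal_inf_lbound; eexists; last reflexivity; split.
  by case: ifPn => // _; rewrite powR_ge0.
have mP s : measurable [set x | s%:E < `|(EFin \o profile v w p) x|].
  rewrite -[X in measurable X]setTI; apply: emeasurable_fun_o_infty => //.
  apply: measurableT_comp => //; apply/measurable_EFinP.
  exact: measurable_profile.
have mS : measurable [set x | (V x <= t)%R].
  rewrite -[X in measurable X]setTI; apply: measurable_fun_le => //.
rewrite -(mu_sublevel (ltW t0)); apply: le_measure; rewrite ?inE// => x /=.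
rewrite lte_fin ger0_norm ?profile_ge0// /profile.
case: ifPn => [tw|wt]; case: ifPn => [Vw|_]; rewrite ?ltxx//; last 2 first.
- by rewrite ltNge powR_ge0.
- by move=> _; rewrite (le_trans Vw)// leNgt.
apply: contraTT; rewrite -ltNge -leNgt => tV.
rewrite !powRN lef_pV2 ?posrE ?powR_gt0 ?lt_max ?v0 ?orbT//.
apply: ge0_ler_powR; last by rewrite ge_max !le_max (ltW tV) lexx orbT.
all: by rewrite ?invr_ge0 ?nnegrE ?le_max ?(ltW p0) ?(ltW v0) ?orbT.
Qed.

Lemma lorentz_norm_profile_le_lny v w p : (0 < v)%R -> (0 < p)%R ->
  lorentz_norm mu p +oo (EFin \o profile v w p) <= 1.
Proof.
move=> v0 p0; apply: ge_ereal_sup => _ [t + <-].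
rewrite /= in_itv/= andbT => t0.
apply: (@le_trans _ _ ((t `^ p^-1)%:E * (Num.max t v `^ (- p^-1))%:E)).
  rewrite lee_wpmul2l ?lee_fin ?powR_ge0//.
  apply: le_trans (rearrangement_profile_le w v0 p0 t0) _.
  by rewrite lee_fin; case: ifPn => // _; rewrite powR_ge0.
rewrite -EFinM lee_fin powRN ler_pdivrMr ?mul1r.
  apply: ge0_ler_powR; rewrite ?invr_ge0 ?nnegrE ?le_max ?lexx ?(ltW p0) ?(ltW t0)//.
by rewrite powR_gt0// lt_max t0.
Qed.

(** On [[v, w]] the integrand is at most [1/t], of integral [ln (w / v)]; on
    [(0, v]] it is at most [(t/v)^(r/p) / t], of integral [p / r]; beyond [w] it
    vanishes. *)
Lemma lorentz_norm_profile_le_fin v w p (r : R) :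
  (0 < v)%R -> (v < w)%R -> (0 < p)%R -> (0 < r)%R ->
  lorentz_norm mu p r%:E (EFin \o profile v w p) <=
  ((p / r + ln (w / v)) `^ r^-1)%:E.
Proof.
move=> v0 vw p0 r0; have w0 := lt_trans v0 vw.
have s0 : (0 < r / p)%R by rewrite divr_gt0.
have lnwv : (0 <= ln (w / v))%R.
  by rewrite ln_ge0// ler_pdivlMr// mul1r ltW.
pose g1 (t : R) := ((v `^ (- (r / p)))%:E * (t `^ (r / p - 1))%:E).
pose A : set R := `]0%R, v]%classic; pose B : set R := `[v, w]%classic.
have mA : measurable A by exact: measurable_itv.
have mB : measurable B by exact: measurable_itv.
have mg1 : measurable_fun A g1.
  apply/measurable_EFinP/measurable_funTS/measurable_funM => //.
have mg2 : measurable_fun B (fun t => (t^-1)%:E) by exact: measurable_inv_itv.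
pose G t := (g1 \_ A) t + ((fun t => (t^-1)%:E) \_ B) t.
have I1 : \int[lebesgue_measure]_(t in A) g1 t <= (p / r)%:E.
  rewrite /g1 ge0_integralZl//=; last 3 first.
  - apply/measurable_EFinP/measurable_funTS; exact: measurable_powR.
  - by move=> t _; rewrite lee_fin powR_ge0.
  - by rewrite lee_fin powR_ge0.
  apply: (@le_trans _ _ ((v `^ (- (r / p)))%:E * (v `^ (r / p) / (r / p))%:E)).
    by rewrite lee_wpmul2l ?lee_fin ?powR_ge0//; exact: integral_powR_near0.
  by rewrite -EFinM powRN mulrA mulVf ?gt_eqF ?powR_gt0// mul1r invf_div.
have I2 := integral_invr_itv v0 vw.
rewrite /lorentz_norm -poweR_EFin.
have g1_ge0 t : 0 <= g1 t by rewrite mule_ge0// lee_fin powR_ge0.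
have inv_ge0 t : B t -> 0 <= (t^-1)%:E.
  rewrite /B/= in_itv/= => /andP[vt _].
  by rewrite lee_fin invr_ge0 (le_trans (ltW v0)).
apply: gt0_ler_poweR; rewrite ?invr_ge0 ?(ltW r0)//.
- rewrite in_itv/= leey andbT integral_ge0// => t; rewrite /= in_itv/= andbT.
  by move=> t0; rewrite mule_ge0 ?poweR_ge0// lee_fin invr_ge0 ltW.
- by rewrite in_itv/= leey andbT lee_fin addr_ge0// divr_ge0// ltW.
apply: (@le_trans _ _ (\int[lebesgue_measure]_t G t)); last first.
  rewrite ge0_integralD//=.
  - rewrite -!integral_mkcond EFinD; apply: leeD => //.
    by rewrite I2 ln_div ?posrE.
  - by move=> t _; apply: erestrict_ge0.
  - by apply/(measurable_restrictT g1 _) => //.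
  - by move=> t _; apply: erestrict_ge0.
  - by apply/(measurable_restrictT (fun t => (t^-1)%:E) _) => //.
rewrite integral_mkcond.
apply: ge0_le_integral_nonmeas => t _.
  apply: erestrict_ge0 => {}t /=; rewrite in_itv/= andbT => t0.
  by rewrite mule_ge0 ?poweR_ge0// lee_fin invr_ge0 ltW.
have G_ge0 : 0 <= G t by apply: adde_ge0; exact: erestrict_ge0.
rewrite patchE; case: ifPn => [|//]; rewrite inE/= in_itv/= andbT => t0.
have rearr_le := rearrangement_profile_le w v0 p0 t0.
have bound (y : R) : (0 <= y)%R ->
    rearrangement mu (EFin \o profile v w p) t <= y%:E ->
    ((t `^ p^-1)%:E * rearrangement mu (EFin \o profile v w p) t) `^ r
      * (t^-1)%:E <= ((t `^ p^-1 * y) `^ r / t)%:E.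
  move=> y0 hy; rewrite EFinM lee_wpmul2r ?lee_fin ?invr_ge0 ?(ltW t0)//.
  rewrite -[leRHS]/((t `^ p^-1 * y)%:E `^ r); apply: gt0_ler_poweR; rewrite ?(ltW r0)//.
  - by rewrite in_itv/= leey andbT mule_ge0 ?rearrangement_ge0// lee_fin powR_ge0.
  - by rewrite in_itv/= leey andbT lee_fin mulr_ge0 ?powR_ge0.
  - by rewrite EFinM lee_wpmul2l// lee_fin powR_ge0.
have [tw|wt] := ltP t w; last first.
  move: rearr_le; rewrite ltNge wt/= => /bound -/(_ (lexx _)) /le_trans -> //.
  by rewrite mulr0 powR0 ?gt_eqF// mul0r.
move: rearr_le; rewrite tw => /bound -/(_ (powR_ge0 _ _)) /le_trans -> //.
have [tv|vt] := leP t v.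
  rewrite -[leLHS]adde0; apply: leeD; last exact: erestrict_ge0.
  rewrite patchE mem_set; last by rewrite /A/= in_itv/= t0.
  rewrite /g1 -EFinM lee_fin powRM ?powR_ge0// -!powRrM mulNr [(p^-1 * r)%R]mulrC.
  rewrite powRB ?powRr1 ?(ltW t0) ?(gt_eqF t0) ?implybT//.
  by rewrite [leLHS]mulrAC [leLHS]mulrC.
rewrite -[leLHS]add0e; apply: leeD; first exact: erestrict_ge0.
rewrite patchE mem_set; last by rewrite /B/= in_itv/= !ltW.
by rewrite powRN mulfV ?gt_eqF ?powR_gt0// powR1 mul1r.
Qed.

(** For [ln (w / v) >= 1] the constant [p / r] from the integral near the origin
    is absorbed by the logarithm. *)
Lemma lorentz_norm_profile_le p q : (0 < p)%R -> 0 < q ->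
  exists2 M : R, (0 < M)%R &
  forall v w, (0 < v)%R -> (v < w)%R -> (1 <= ln (w / v))%R ->
    lorentz_norm mu p q (EFin \o profile v w p) <=
    (M * ln (w / v) `^ inv_exponent q)%:E.
Proof.
move=> p0; case: q => [r| |]//; last first.
  move=> _; exists 1%R => // v w v0 _ _; rewrite mul1r powRr0.
  exact: lorentz_norm_profile_le_lny.
rewrite lte_fin => r0.
have pr0 : (0 < p / r)%R by rewrite divr_gt0.
exists ((p / r + 1) `^ r^-1)%R; first by rewrite powR_gt0// ltr_wpDl// ltW.
move=> v w v0 vw ln1; apply: le_trans (lorentz_norm_profile_le_fin v0 vw p0 r0) _.
have ln0 : (0 <= ln (w / v))%R by exact: le_trans ln1.
rewrite lee_fin /inv_exponent -powRM ?(addr_ge0 (ltW pr0))//.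
apply: ge0_ler_powR; rewrite ?nnegrE ?invr_ge0 ?mulr_ge0 ?addr_ge0 ?(ltW pr0) ?(ltW r0)//.
by rewrite mulrDl mul1r lerD2r ler_peMr// ltW.
Qed.

End profile.

(** * Cubes in Euclidean space *)

Lemma measurable_tuple_box d (T : measurableType d) k (A : set T) :
  measurable A -> measurable [set x : k.-tuple T | forall j, A (tnth x j)].
Proof.
move=> mA.
rewrite (_ : [set x | _] = \bigcap_(j in [set: 'I_k]) ((@tnth k T)^~ j @^-1` A)).
  apply: fin_bigcap_measurable; first exact: finite_finset.
  by move=> j _; rewrite -[X in measurable X]setTI; exact: measurable_tnth.
by apply/seteqP; split=> x h j; [move=> _|]; exact: (h j).
Qed.

Lemma power_measure_box d (T : measurableType d) (R : realType)
    (mu : {sigma_finite_measure set T -> \bar R}) k (A : set T) :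
  measurable A ->
  power_measure mu k [set x | forall j, A (tnth x j)] = mu A ^+ k.
Proof.
move=> mA; elim: k => [|k IHk].
  by rewrite /= diracE mem_set// => -[].
rewrite [LHS]/(pushforward (mu \x power_measure mu k)%E (@cons_pair T k) _).
rewrite /pushforward.
rewrite (_ : _ @^-1` _ = A `*` [set x | forall j, A (tnth x j)]).
  by rewrite product_measure1E ?IHk ?expeS//; exact: measurable_tuple_box.
apply/seteqP; split => -[x y] /=.
  move=> h; split; first by have := h ord0; rewrite tnth0.
  by move=> j; have := h (lift ord0 j); rewrite tnthS.
move=> [Ax h] j; case: (unliftP ord0 j) => [i|] ->; last by rewrite tnth0.
by rewrite tnthS.
Qed.

Section cube_volume.
Context (R : realType) (n : nat).
Implicit Types (x y : n.-tuple R) (t : R).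

Definition sup_norm x : R := (\big[Num.max/0]_(j < n) `|tnth x j|)%R.

(** The Lebesgue measure of the smallest cube centred at [0] that contains [x].
    Measuring size by volume makes its sublevel set at [t] have measure [t]
    when [n > 0]. *)
Definition cube_volume x : R := ((2 * sup_norm x) ^+ n)%R.

Lemma sup_norm_ge0 x : (0 <= sup_norm x)%R.
Proof. by rewrite /sup_norm bigmax_idl le_max lexx. Qed.

Lemma sup_norm_le x (s : R) : (0 <= s)%R ->
  (sup_norm x <= s)%R <-> (forall j, `|tnth x j| <= s)%R.
Proof.
move=> s0; split=> [xs j|xs]; last exact: bigmax_le.
by apply: le_trans xs; exact: le_bigmax.
Qed.

Lemma cube_volume_ge0 x : (0 <= cube_volume x)%R.
Proof. by rewrite exprn_ge0// mulr_ge0// sup_norm_ge0. Qed.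

(** The triangle inequality for the sup norm: a sum of two norms is at most
    twice the larger one, and volumes scale with the power [n]. *)
Lemma cube_volume_sub x y : (cube_volume (euclid_sub x y) <=
  2 ^+ n * Num.max (cube_volume x) (cube_volume y))%R.
Proof.
have key (a : R) : (sup_norm x <= a -> sup_norm y <= a ->
    cube_volume (euclid_sub x y) <= 2 ^+ n * (2 * a) ^+ n)%R.
  move=> xa ya; have a0 : (0 <= a)%R by exact: le_trans (sup_norm_ge0 x) xa.
  rewrite -exprMn lerXn2r ?nnegrE ?mulr_ge0 ?sup_norm_ge0// ler_pM2l//.
  apply/sup_norm_le; first by rewrite mulr_ge0.
  move=> j; rewrite tnth_mktuple mulr_natl mulr2n.
  apply: le_trans (ler_normB _ _) _; apply: lerD.
    by apply: (sup_norm_le x a0).1.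
  by apply: (sup_norm_le y a0).1.
have [xy|yx] := leP (sup_norm x) (sup_norm y).
  apply: le_trans (key _ xy (lexx _)) _.
  by rewrite ler_pM2l ?exprn_gt0// le_max lexx orbT.
apply: le_trans (key _ (lexx _) (ltW yx)) _.
by rewrite ler_pM2l ?exprn_gt0// le_max lexx.
Qed.

(** Lebesgue measure is the restriction of an outer measure, which is monotone
    on arbitrary sets. *)
Lemma le_lebesgue (A B : set (euclid R n)) : A `<=` B ->
  lebesgue R n A <= lebesgue R n B.
Proof. exact: (le_outer_measure (borel_lebesgue R n)^*%mu). Qed.

Lemma borel_measurable_euclid (A : set (n.-tuple (measurableTypeR R))) :
  measurable A -> measurable (A : set (euclid R n)).
Proof. by move=> mA; apply: sub_caratheodory; exact: sub_sigma_algebra. Qed.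

Lemma borel_measurable_cube_volume :
  measurable_fun setT (cube_volume : n.-tuple (measurableTypeR R) -> R).
Proof.
apply: (@measurable_funX _ _ _ _ (fun x => 2 * sup_norm x)%R).
apply: measurable_funM; first exact: measurable_cst.
rewrite /sup_norm; elim: (index_enum _) => [|j l IHl].
  by under eq_fun do rewrite big_nil; exact: measurable_cst.
under eq_fun do rewrite big_cons.
apply: measurable_maxr IHl.
apply: (measurableT_comp (@normr_measurable R setT)).
exact: measurable_tnth.
Qed.

Lemma measurable_cube_volume :
  measurable_fun setT (cube_volume : euclid R n -> R).
Proof.
move=> _ Y mY; rewrite setTI; apply: borel_measurable_euclid.
by rewrite -[X in measurable X]setTI; exact: borel_measurable_cube_volume.
Qed.

Lemma lebesgue_cube (s : R) : (0 <= s)%R ->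
  lebesgue R n [set x | (sup_norm x <= s)%R] = ((2 * s) ^+ n)%:E.
Proof.
move=> s0; pose I : set (measurableTypeR R) := `[(- s)%R, s]%classic.
have mI : measurable I by exact: measurable_itv.
have muI : lebesgue_measure I = (2 * s)%:E.
  rewrite [LHS]lebesgue_measure_itv/= lte_fin.
  have [s_gt0|s_le0] := ltP 0%R s.
    by rewrite gtrN// -EFinB opprK mulr_natl mulr2n.
  have -> : s = 0%R by apply/eqP; rewrite eq_le s_le0.
  by rewrite oppr0 ltxx mulr0.
rewrite (_ : [set x | _] = [set x : n.-tuple _ | forall j, I (tnth x j)]).
  rewrite [LHS](@measurable_mu_extE _ _ _ (borel_lebesgue R n)); last first.
    exact: measurable_tuple_box.
  by rewrite [LHS]power_measure_box// EFin_expe -muI.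
apply/seteqP; split => x /= h.
  move=> j; rewrite /I/= in_itv/= -ler_norml; exact: (sup_norm_le x s0).1.
by apply/sup_norm_le => // j; have := h j; rewrite /I/= in_itv/= -ler_norml.
Qed.

Lemma lebesgue_cube_volume_le t : (0 < n)%N -> (0 <= t)%R ->
  lebesgue R n [set x | (cube_volume x <= t)%R] = t%:E.
Proof.
move=> n0 t0; pose s : R := (t `^ n%:R^-1 / 2)%R.
have s0 : (0 <= s)%R by rewrite divr_ge0 ?powR_ge0.
have sn : ((2 * s) ^+ n = t)%R.
  rewrite /s mulrCA mulfV// mulr1 -powR_mulrn ?powR_ge0// -powRrM mulVf ?powRr1//.
  by rewrite pnatr_eq0 -lt0n.
have VE (x : euclid R n) : (cube_volume x <= t)%R = (sup_norm x <= s)%R.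
  rewrite -[in LHS]sn ler_pXn2r ?nnegrE ?mulr_ge0 ?sup_norm_ge0 ?powR_ge0//.
  by rewrite ler_pM2l.
rewrite -[in RHS]sn -lebesgue_cube//; congr (lebesgue R n _).
by apply/seteqP; split => x /=; rewrite VE.
Qed.

End cube_volume.

(** * Lower bound for the multilinear convolution *)

Lemma prod_powR (R : realType) (I : finType) (x : R) (a : I -> R) :
  (0 < x)%R -> (\prod_i x `^ a i = x `^ (\sum_i a i))%R.
Proof.
move=> x0; elim/big_rec2 : _ => [|i s y _ ->]; first by rewrite powRr0.
by rewrite powRD// (gt_eqF x0) implybT.
Qed.

Lemma lee_prod_EFin (R : realType) (I : finType) (x : I -> \bar R) (y : I -> R) :
  (forall i, 0 <= x i) -> (forall i, x i <= (y i)%:E) ->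
  \prod_i x i <= (\prod_i y i)%:E.
Proof.
move=> x0 xy.
suff /andP[] : 0 <= \prod_i x i <= (\prod_i y i)%:E by [].
elim/big_rec2 : _ => [|i s t _ /andP[t0 ts]]; first by rewrite lee01 lexx.
by rewrite mule_ge0// EFinM lee_pmul.
Qed.

Definition cube_profile (R : realType) (n : nat) (v w p : R) :
    euclid R n -> R :=
  @profile _ (euclid R n) R (@cube_volume R n) v w p.

Section kernel.
Context (R : realType) (n m : nat) (K : euclid_pow R n m -> R).
Hypothesis mK : measurable_fun setT K.
Hypothesis K_ge0 : forall y, (0 <= K y)%R.

Definition cube_product (v : R) : set (euclid_pow R n m) :=
  [set y | forall i, (cube_volume (tnth y i) <= v)%R].

Lemma measurable_cube_product v : measurable (cube_product v).
Proof.
apply: sub_caratheodory; apply: sub_sigma_algebra.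
apply: (@measurable_tuple_box _ (n.-tuple (measurableTypeR R)) m
  [set x | (cube_volume x <= v)%R]).
rewrite -[X in measurable X]setTI; apply: measurable_fun_le => //.
exact: borel_measurable_cube_volume.
Qed.

(** The products of cubes exhaust the space.  If [K] integrated to [0] on each of
    them, it would vanish almost everywhere on each, hence [[K != 0]] would be a
    countable union of null sets. *)
Lemma kernel_mass_near0 : 0 < lebesgue_pow R n m [set y | K y != 0%R] ->
  exists2 v0 : R, (0 < v0)%R & exists2 c : R, (0 < c)%R &
    c%:E <= \int[lebesgue_pow R n m]_(y in cube_product v0) (K y)%:E.
Proof.
move=> K_neq0.
have [[k Ik]|I0] := pselect (exists k : nat,
    0 < \int[lebesgue_pow R n m]_(y in cube_product k.+1%:R) (K y)%:E).
  exists k.+1%:R => //.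
  case: (\int[_]_(y in _) _) Ik => [c| |]//; first by exists c; rewrite -?lte_fin.
  by exists 1%R => //; rewrite leey.
exfalso; move: K_neq0; apply/negP; rewrite -leNgt.
have mN : measurable [set y | K y != 0%R].
  rewrite -[X in measurable X]setTI.
  have := mK measurableT (measurableC (measurable_set1 (0%R : R))).
  rewrite (_ : ~` [set 0%R] = [set z | z != 0%R])//.
  by apply/seteqP; split => z /= /eqP.
suff : (lebesgue_pow R n m).-negligible [set y | K y != 0%R].
  by move/negligibleP => ->.
apply: (@negligibleS _ _ _ _ (\bigcup_k
    [set y | ~ (cube_product k.+1%:R y -> (K y)%:E = 0)])).
  move=> y /= Ky; pose s := (\sum_i cube_volume (tnth y i))%R.
  (* the sum [s] of the volumes bounds each of them *)
  exists (Num.truncn s) => //= h.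
  have : (K y)%:E = 0.
    apply: h => i; apply: le_trans (ltW (truncnS_gt s)).
    rewrite /s (bigD1 i)//= lerDl sumr_ge0// => j _; exact: cube_volume_ge0.
  by case=> /eqP; rewrite (negbTE Ky).
apply: negligible_bigcup => k.
apply: (ae_eq_integral_abs _ (measurable_cube_product _) _).1.
  by apply/measurable_EFinP; exact: measurable_funTS.
apply/eqP; rewrite eq_le integral_ge0// andbT leNgt; apply/negP => h.
apply: I0; exists k; move: h.
by under eq_integral do rewrite gee0_abs ?lee_fin//.
Qed.

(** When each [y_i] stays in the cube of volume [v0 <= v], every factor
    [f_i (x - y_i)] is at least the value of [f_i] at volume
    [2^n max(V x, v)]; what remains is the integral of [K]. *)
Lemma multilinear_conv_profile_ge (ps : 'I_m -> R) (v0 c v w : R)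
    (x : euclid R n) :
  (forall i, 0 < ps i)%R -> (0 < v0)%R -> (0 <= c)%R ->
  c%:E <= \int[lebesgue_pow R n m]_(y in cube_product v0) (K y)%:E ->
  (v0 <= v)%R -> (2 ^+ n * Num.max (cube_volume x) v <= w)%R ->
  (c * (2 ^+ n * Num.max (cube_volume x) v) `^ (- \sum_i (ps i)^-1))%:E <=
  multilinear_conv K (fun i => cube_profile v w (ps i)) x.
Proof.
move=> ps0 v00 c0 cK v0v; set b := (2 ^+ n * _)%R => bw.
have v_gt0 : (0 < v)%R by exact: lt_le_trans v0v.
have b0 : (0 < b)%R by rewrite mulr_gt0 ?exprn_gt0// lt_max v_gt0 orbT.
set A := (b `^ _)%R.
have A0 : (0 <= A)%R by exact: powR_ge0.
apply: (@le_trans _ _ (\int[lebesgue_pow R n m]_(y in cube_product v0)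
    (A%:E * (K y)%:E))).
  rewrite ge0_integralZl//; first by rewrite mulrC EFinM lee_wpmul2l.
  - exact: measurable_cube_product.
  - by apply/measurable_EFinP; exact: measurable_funTS.
  - by move=> y _; rewrite lee_fin.
rewrite /multilinear_conv integral_mkcond; apply: ge0_le_integral_nonmeas => y _.
  by apply: erestrict_ge0 => z _; rewrite mule_ge0// lee_fin.
have prod_ge0 : (0 <= \prod_(i < m)
    cube_profile v w (ps i) (euclid_sub x (tnth y i)))%R.
  by apply: prodr_ge0 => i _; exact: profile_ge0.
rewrite patchE; case: ifPn => [|_]; last by rewrite lee_fin mulr_ge0.
rewrite inE => yv; rewrite -EFinM lee_fin ler_wpM2r//.
rewrite /A -sumrN -prod_powR//; apply: ler_prod => i _.
rewrite powR_ge0/=.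
have Vb : (cube_volume (euclid_sub x (tnth y i)) <= b)%R.
  apply: le_trans (cube_volume_sub _ _) _; rewrite ler_pM2l ?exprn_gt0//.
  by rewrite ge_max !le_max lexx/= (le_trans (yv i) v0v) orbT.
have vb : (v <= b)%R.
  apply: (@le_trans _ _ (Num.max (cube_volume x) v)).
    by rewrite le_max lexx orbT.
  by rewrite ler_peMl// ?le_max ?cube_volume_ge0// exprn_ege1// ler1n.
rewrite /cube_profile /profile (le_trans Vb bw) !powRN
  lef_pV2 ?posrE ?powR_gt0//; last first.
  by rewrite lt_max v_gt0 orbT.
apply: ge0_ler_powR; last by rewrite ge_max Vb vb.
- by rewrite invr_ge0 ltW.
- by rewrite nnegrE le_max (ltW v_gt0) orbT.
- by rewrite nnegrE ltW.
Qed.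

End kernel.

(** * The scaling estimate and its consequences *)

Lemma inv_exponent_ge0 (R : realType) (q : \bar R) :
  0 < q -> (0 <= inv_exponent q)%R.
Proof. by case: q => [r| |]//; rewrite lte_fin /= invr_ge0 => /ltW. Qed.

Lemma inve_inv_exponent (R : realType) (q : \bar R) :
  0 < q -> q^-1 = (inv_exponent q)%:E.
Proof.
case: q => [r| |]//; rewrite lte_fin => r0.
by rewrite inver gt_eqF.
Qed.

Lemma lorentz_norm_ge0 d (T : measurableType d) (R : realType)
    (mu : {measure set T -> \bar R}) (p : R) (q : \bar R) (F : T -> \bar R) :
  0 <= lorentz_norm mu p q F.
Proof.
case: q => [r| |]//=; first exact: poweR_ge0.
apply: (@le_trans _ _ ((1 `^ p^-1)%:E * rearrangement mu F 1)).
  by rewrite mule_ge0 ?rearrangement_ge0// lee_fin powR_ge0.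
by apply: ereal_sup_ubound; exists 1%R => //=; rewrite in_itv/= ltr01.
Qed.

Lemma cube_profile_bound (R : realType) (n : nat) (p : R) (q : \bar R) :
  (0 < n)%N -> (0 < p)%R -> 0 < q ->
  exists M : R, (0 <= M)%R /\ forall v w, (0 < v)%R -> (v < w)%R -> (1 <= ln (w / v))%R ->
    lorentz_norm (lebesgue R n) p q (EFin \o cube_profile v w p) <=
    (M * ln (w / v) `^ inv_exponent q)%:E.
Proof.
move=> n0 p0 q0; have := lorentz_norm_profile_le
  (@measurable_cube_volume R n) (fun t => @lebesgue_cube_volume_le R n t n0) p0 q0.
by case=> M M0 h; exists M; split => //; exact: ltW.
Qed.

(** The rearrangement at [t] is bounded below through the cube of volume [2 t]:
    its measure must exceed [t] strictly, hence the factor [2], and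
    [2^n * (2 t) <= w] for [t <= v e^L] explains the choice of [w].  The
    hypothesis [s <= 1/p] makes [t^(1/p - s)] smallest at [t = v]. *)
Lemma multilinear_conv_lorentz_ge (R : realType) (n m : nat) (p : R)
    (q : \bar R) (ps : 'I_m -> R) (K : euclid_pow R n m -> R) (v0 c v L : R) :
  let s := (\sum_(i < m) (ps i)^-1)%R in
  let w := (2 ^+ n.+1 * v * expR L)%R in
  (0 < n)%N -> 0 < q ->
  (forall i, 0 < ps i)%R -> measurable_fun setT K -> (forall y, 0 <= K y)%R ->
  (0 < v0)%R -> (0 <= c)%R ->
  c%:E <= \int[lebesgue_pow R n m]_(y in @cube_product R n m v0) (K y)%:E ->
  (s <= p^-1)%R -> (v0 <= v)%R -> (0 < L)%R ->
  (c * (2 ^+ n.+1) `^ (- s) * v `^ (p^-1 - s) * L `^ inv_exponent q)%:E <=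
  lorentz_norm (lebesgue R n) p q
    (multilinear_conv K (fun i => cube_profile v w (ps i))).
Proof.
move=> s w n0 q0 ps0 mK K0 v00 c0 cK sp v0v L0.
have v_gt0 : (0 < v)%R by exact: lt_le_trans v0v.
have s0 : (0 <= s)%R by apply: sumr_ge0 => i _; rewrite invr_ge0 ltW.
have vL : (v < v * expR L)%R by rewrite ltr_pMr// expR_gt1.
have lnL : L = ln (v * expR L / v) by rewrite mulrAC mulfV ?gt_eqF// mul1r expRK.
rewrite [in leLHS]lnL; apply: lorentz_norm_ge => //.
  by rewrite !mulr_ge0// powR_ge0.
move=> t /andP[vt tL]; have t0 : (0 < t)%R by exact: lt_le_trans vt.
apply: (@le_trans _ _ ((t `^ p^-1)%:E * (c * (2 ^+ n.+1 * t) `^ (- s))%:E)).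
  rewrite -EFinM lee_fin powRM ?exprn_ge0 ?(ltW t0)//.
  rewrite mulrCA [X in (_ <= _ * X)%R]mulrCA -mulrA ler_wpM2l//.
  rewrite ler_wpM2l ?powR_ge0// -powRD ?(gt_eqF t0) ?implybT//.
  by rewrite ge0_ler_powR ?nnegrE ?subr_ge0// ltW.
rewrite lee_wpmul2l ?lee_fin ?powR_ge0//.
apply: (@rearrangement_ge _ _ _ _ _ [set x : euclid R n | (cube_volume x <= 2 * t)%R]).
- by move=> B; exact: le_lebesgue.
- rewrite lebesgue_cube_volume_le//; last by rewrite mulr_ge0// ltW.
  by rewrite lte_fin ltr_pMl// ltr1n.
move=> x /= xt; apply: le_trans (lee_abs _).
have mt : (2 ^+ n * Num.max (cube_volume x) v <= 2 ^+ n.+1 * t)%R.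
  rewrite exprSr -mulrA ler_pM2l ?exprn_gt0// ge_max xt/=.
  by rewrite (le_trans vt)// ler_peMl ?(ltW t0)// ler1n.
apply: le_trans (multilinear_conv_profile_ge mK K0 ps0 v00 c0 cK v0v _); last first.
  by apply: (le_trans mt); rewrite /w -mulrA ler_pM2l// exprn_gt0.
rewrite lee_fin ler_wpM2l// -/s !powRN
  lef_pV2 ?posrE ?powR_gt0 ?mulr_gt0 ?exprn_gt0//; last first.
  by rewrite lt_max v_gt0 orbT.
rewrite ge0_ler_powR ?nnegrE ?mulr_ge0 ?exprn_ge0 ?(ltW t0)//.
by rewrite le_max (ltW v_gt0) orbT.
Qed.

(** The two free parameters, the inner scale [v] and the logarithmic length [L],
    separate the two necessary conditions. *)
Lemma scaling_estimate (R : realType) (n m : nat) (p : R) (q : \bar R)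
    (ps : 'I_m -> R) (qs : 'I_m -> \bar R) (K : euclid_pow R n m -> R) :
  (0 < n)%N -> 0 < q ->
  (forall i, 0 < ps i)%R -> (forall i, 0 < qs i) ->
  measurable_fun setT K -> (forall y, 0 <= K y)%R ->
  0 < lebesgue_pow R n m [set y | K y != 0%R] ->
  (exists C : R, (0 < C)%R /\
     forall f : 'I_m -> euclid R n -> R,
       (forall i, lorentz_space (lebesgue R n) (ps i) (qs i) (f i)) ->
       lorentz_norm (lebesgue R n) p q (multilinear_conv K f)
         <= C%:E * \prod_(i < m)
              lorentz_norm (lebesgue R n) (ps i) (qs i) (EFin \o f i)) ->
  let s := (\sum_(i < m) (ps i)^-1)%R in
  (s <= p^-1)%R ->
  exists2 a : R, (0 < a)%R & exists M v0 : R, forall v L,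
    (v0 <= v)%R -> (1 <= L)%R ->
    (a * v `^ (p^-1 - s) * L `^ inv_exponent q <=
     M * L `^ (\sum_(i < m) inv_exponent (qs i)))%R.
Proof.
move=> n0 q0 ps0 qs0 mK K0 K_neq0 [C [C0 bounded]] s sp.
have [v0 v00 [c c0 cK]] := kernel_mass_near0 mK K0 K_neq0.
have /choice[M hM] := fun i => cube_profile_bound n0 (ps0 i) (qs0 i).
exists (c * (2 ^+ n.+1) `^ (- s))%R.
  by rewrite mulr_gt0// powR_gt0// exprn_gt0.
set b := (\sum_(i < m) inv_exponent (qs i))%R.
pose h : R := (ln (2 ^+ n.+1) + 1)%R.
have ln2_ge0 : (0 <= ln (2 ^+ n.+1 : R))%R by rewrite ln_ge0// exprn_ege1// ler1n.
have h0 : (0 < h)%R by rewrite ltr_wpDl.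
exists (C * \prod_i M i * h `^ b)%R, v0 => v L v0v L1.
have v_gt0 : (0 < v)%R by exact: lt_le_trans v0v.
have L0 : (0 < L)%R by exact: lt_le_trans L1.
have := multilinear_conv_lorentz_ge n0 q0 ps0 mK K0 v00 (ltW c0) cK sp v0v L0.
rewrite -/s; set w := (2 ^+ n.+1 * v * expR L)%R => lower.
have vw : (v < w)%R.
  rewrite /w mulrAC ltr_pMl//.
  rewrite -[X in (X < _)%R]mulr1 ltr_pM// ?expR_gt1//.
  by rewrite exprn_egt1// ltr1n.
have lnw : ln (w / v) = (ln (2 ^+ n.+1) + L)%R.
  rewrite /w mulrAC mulfK ?gt_eqF//.
  by rewrite lnM ?posrE ?exprn_gt0 ?expR_gt0// expRK.
have lnw1 : (1 <= ln (w / v))%R by rewrite lnw (le_trans L1)// lerDr.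
have lnwh : (ln (w / v) <= h * L)%R.
  by rewrite lnw /h mulrDl mul1r lerD2r ler_peMr.
have norm_le i : lorentz_norm (lebesgue R n) (ps i) (qs i)
    (EFin \o cube_profile v w (ps i)) <=
    (M i * (h * L) `^ inv_exponent (qs i))%:E.
  have [M0 hMi] := hM i.
  apply: le_trans (hMi v w v_gt0 vw lnw1) _; rewrite lee_fin ler_wpM2l//.
  rewrite ge0_ler_powR ?inv_exponent_ge0// nnegrE.
    by rewrite (le_trans _ lnw1).
  by rewrite mulr_ge0// ltW.
have norm_ge0 i : 0 <= lorentz_norm (lebesgue R n) (ps i) (qs i)
    (EFin \o cube_profile v w (ps i)).
  exact: lorentz_norm_ge0.
have inL i : lorentz_space (lebesgue R n) (ps i) (qs i) (cube_profile v w (ps i)).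
  split; first exact: (measurable_profile (@measurable_cube_volume R n)).
  by rewrite (le_lt_trans (norm_le i))// ltry.
have := le_trans lower (le_trans (bounded _ inL)
  (lee_wpmul2l (ltW _) (lee_prod_EFin norm_ge0 norm_le))).
rewrite lte_fin => /(_ C0); rewrite -EFinM lee_fin => /le_trans; apply.
rewrite big_split/= prod_powR ?mulr_gt0// powRM ?(ltW h0) ?(ltW L0)//.
by rewrite !mulrA.
Qed.

Theorem theorem2p3 (R : realType) (n m : nat) (p : R) (q : \bar R)
    (ps : 'I_m -> R) (qs : 'I_m -> \bar R) (K : euclid_pow R n m -> R)
    (hn : (0 < n)%N) (hm : (0 < m)%N)
    (hp : (0 < p)%R) (hq : 0 < q)
    (hps : forall i, (0 < ps i)%R) (hqs : forall i, 0 < qs i)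
    (mK : measurable_fun setT K) (K_ge0 : forall y, (0 <= K y)%R)
    (K_neq0 : 0 < lebesgue_pow R n m [set y | K y != 0%R])
    (bounded : exists C : R, (0 < C)%R /\
       forall f : 'I_m -> euclid R n -> R,
         (forall i, lorentz_space (lebesgue R n) (ps i) (qs i) (f i)) ->
         lorentz_norm (lebesgue R n) p q (multilinear_conv K f)
           <= C%:E * \prod_(i < m)
                lorentz_norm (lebesgue R n) (ps i) (qs i) (EFin \o f i)) :
  (p^-1 <= \sum_(i < m) (ps i)^-1)%R /\
  (p^-1%R = (\sum_(i < m) (ps i)^-1)%R -> q^-1 <= \sum_(i < m) (qs i)^-1).
Proof.
have est := scaling_estimate hn hq hps hqs mK K_ge0 K_neq0 bounded.
split.
  rewrite leNgt; apply/negP => sp.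
  have [a a0 [M [v0 h]]] := est (ltW sp).
  have : (p^-1 - \sum_(i < m) (ps i)^-1 <= 0)%R.
    apply: (@powR_growth_le _ _ _ a M v0 a0) => v v0v.
    by have := h v 1%R v0v (lexx _); rewrite !powR1 powRr0 !mulr1.
  by rewrite subr_le0 leNgt sp.
move=> ps_eq.
have [|a a0 [M [v0 h]]] := est; first by rewrite ps_eq.
rewrite inve_inv_exponent//.
under eq_bigr do rewrite inve_inv_exponent//.
rewrite sumEFin lee_fin; apply: (@powR_growth_le _ _ _ a M 1%R a0) => L L1.
by have := h v0 L (lexx _) L1; rewrite -ps_eq subrr powRr0 mulr1.
Qed.
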